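(* Let $\gamma>0$, $p>0$, $p_2\ge p$, $b>0$, $q_{\max}>b+p/\gamma$. For every probability of call $p_r\in[0,1]$, the optimal expected profit of a consumer under the demand response contract, $$J^*=\max_{0\le \hat q\le\hat b\le q_{\max}}\Big\{p_r\max_{q\in[0,q_{\max}]}\big[G(q;b)-\pi_3^{1}(q;\hat b,\hat q)\big]+(1-p_r)\max_{q\in[0,q_{\max}]}\big[G(q;b)-\pi_3^{0}(q;\hat b,\hat q)\big]\Big\},$$ is at least the optimal payoff of a consumer who does not sign the contract: $$J^*\;\ge\;\max_{q\in[0,q_{\max}]}\{G(q;b)-pq\}=\frac{\gamma b^2}{2}.$$ (Individual rationality.)
   Context: Notation: $(x)_+=\max(x,0)$. All quantities are real numbers for a single consumer: $b$ is the true baseline, $\gamma$ the marginal-utility parameter, $p$ the energy price, $p_2$ the incentive/penalty price, $q_{\max}$ the maximum allowable consumption, $\hat b$ the reported baseline, $\hat q$ the reported reduced consumption under demand response, $q$ the actual consumption, and $r\in\{0,1\}$ indicates whether the consumer is called ($r=1$) or not ($r=0$), with $\Pr(r=1)=p_r$. The contract requires $\hat b\ge\hat q$. Utility function: $$G(q;b)=\begin{cases}-\frac{\gamma}{2}q^2+(\gamma b+p)q & 0\le q\le b+\frac{p}{\gamma},\\ \frac{p^2}{2\gamma}+\frac{\gamma b^2}{2}+pb & q>b+\frac{p}{\gamma}.\end{cases}$$ Payment scheme of the contract: $$\pi_3^{r}(q;\hat b,\hat q)=\begin{cases}p\max(\hat b,q) & r=0,\\ pq-p_2(\hat b-q)_+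 +p_2|q-\hat q| & r=1.\end{cases}$$ *)

(* Defs.v *)
From mathcomp Require Import all_boot all_order all_algebra.
From mathcomp Require Import all_classical all_reals.

Set Implicit Arguments.
Unset Strict Implicit.
Unset Printing Implicit Defensive.

Import Order.TTheory GRing.Theory Num.Theory.
Local Open Scope classical_set_scope.
Local Open Scope ring_scope.

(* [maximum D f] is a supremum, hence total; it equals the maximum of [f]
   over [D] whenever [has_maximum D f] holds. *)
Definition maximum (R : realType) (T : Type) (D : set T) (f : T -> R) : R :=
  sup (f @` D).

Definition has_maximum (R : realType) (T : Type) (D : set T) (f : T -> R) : Prop :=
  exists2 x, D x & forall y, D y -> f y <= f x.

Definition pospart (R : realType) (x : R) : R := Num.max x 0.

(* Only used for [0 <= q]. *)
Definition utility (R : realType) (gamma p b q : R) : R :=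
  if q <= b + p / gamma then - (gamma / 2) * q ^+ 2 + (gamma * b + p) * q
  else p ^+ 2 / (2 * gamma) + gamma * b ^+ 2 / 2 + p * b.

(* [r = true] means that the consumer is called. *)
Definition payment (R : realType) (p p2 : R) (r : bool) (bhat qhat q : R) : R :=
  if r then p * q - p2 * pospart (bhat - q) + p2 * `|q - qhat|
  else p * Num.max bhat q.

Definition contract_profit (R : realType) (gamma p p2 b : R) (r : bool)
    (bhat qhat q : R) : R :=
  utility gamma p b q - payment p p2 r bhat qhat q.

Definition no_contract_profit (R : realType) (gamma p b q : R) : R :=
  utility gamma p b q - p * q.

Definition consumptions (R : realType) (qmax : R) : set R :=
  [set q | 0 <= q <= qmax].

(* Reports are pairs [(bhat, qhat)]. *)
Definition reports (R : realType) (qmax : R) : set (R * R) :=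
  [set x | 0 <= x.2 /\ x.2 <= x.1 /\ x.1 <= qmax].

Definition expected_profit (R : realType) (gamma p p2 b qmax pr : R)
    (x : R * R) : R :=
  pr * maximum (consumptions qmax) (contract_profit gamma p p2 b true x.1 x.2)
  + (1 - pr) *
    maximum (consumptions qmax) (contract_profit gamma p p2 b false x.1 x.2).

Definition optimal_expected_profit (R : realType)
    (gamma p p2 b qmax pr : R) : R :=
  maximum (reports qmax) (expected_profit gamma p p2 b qmax pr).

Definition optimal_no_contract_profit (R : realType) (gamma p b qmax : R) : R :=
  maximum (consumptions qmax) (no_contract_profit gamma p b).

(* Main.v *)
Require Import Defs.
From mathcomp Require Import all_boot all_order all_algebra.
From mathcomp Require Import all_classical all_reals.
From mathcomp Require Import topology normedtype derive.
From mathcomp Require Import ring lra.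
Import Order.TTheory GRing.Theory Num.Theory.
Import numFieldNormedType.Exports.
Local Open Scope ring_scope.
Local Open Scope classical_set_scope.

(** Every maximum is attained because the profit is jointly continuous on a
    compact set; for the outer maximum one maximises simultaneously over the
    report and the two consumptions, which is legitimate since the weights
    [pr] and [1 - pr] are nonnegative. Reporting truthfully [bhat = qhat = b]
    and consuming [b] yields the no-contract optimum in either state, which
    gives individual rationality. *)

(** The maximiser [x] makes the image nonempty and bounded above, so [sup] is a genuine least upper
    bound here and not its default value. *)
Lemma maximumE {R : realType} {T : Type} (D : set T) (f : T -> R) (x : T) :
  D x -> (forall y, D y -> f y <= f x) -> maximum D f = f x.
Proof.
move=> Dx fmax; apply/eqP; rewrite eq_le; apply/andP; split.
  by apply: ge_sup => [|_ [y Dy <-]]; [exists (f x), x | exact: fmax].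
by apply: ub_le_sup; [exists (f x) => _ [y Dy <-]; exact: fmax | exists x].
Qed.

Lemma has_maximumP {R : realType} {T : Type} (D : set T) (f : T -> R) :
  has_maximum D f ->
  exists x, [/\ D x, maximum D f = f x & forall y, D y -> f y <= f x].
Proof. by case=> x Dx fmax; exists x; split=> //; exact: maximumE. Qed.

Lemma le_maximum {R : realType} {T : Type} (D : set T) (f : T -> R) (x : T) :
  has_maximum D f -> D x -> f x <= maximum D f.
Proof. by move=> /has_maximumP[y [_ -> fmax]] Dx; exact: fmax. Qed.

Lemma continuous_has_maximum {R : realType} {T : topologicalType}
    (D : set T) (f : T -> R) :
  D !=set0 -> compact D -> continuous f -> has_maximum D f.
Proof.
move=> D0 cD cf.
have [|x xD fmax] := @compact_EVT_max T R f D D0 cD.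
  exact: continuous_subspaceT.
by exists x => [|y Dy]; [rewrite inE in xD | apply: fmax; rewrite inE].
Qed.

(** Past the saturation point [b + p / gamma] the utility keeps the value that the quadratic takes
    there. Truncating the argument instead of splitting cases makes continuity immediate. *)
Lemma utility_min {R : realType} (gamma p b q : R) : gamma != 0 ->
  let m := Num.min q (b + p / gamma) in
  utility gamma p b q = - (gamma / 2) * m ^+ 2 + (gamma * b + p) * m.
Proof. by move=> g0 /=; rewrite /utility; case: leP => // _; field. Qed.

Section continuity.
Context {R : realType} {T : topologicalType}.
Implicit Types f g h : T -> R.

Lemma continuous_utility (gamma p b : R) f : gamma != 0 -> continuous f ->
  continuous (fun t => utility gamma p b (f t)).
Proof.
move=> g0 cf t.
under eq_fun do rewrite utility_min//.
have cm : {for t, continuous (fun t => Num.min (f t) (b + p / gamma))}.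
  by apply: (@continuous_min R T f (cst _)); [exact: cf | exact: cvg_cst].
apply: (@cvgD R R^o); apply: cvgM; try exact: cvg_cst; last exact: cm.
by apply: cvgM; exact: cm.
Qed.

Lemma continuous_payment (p p2 : R) (r : bool) f g h :
  continuous f -> continuous g -> continuous h ->
  continuous (fun t => payment p p2 r (f t) (g t) (h t)).
Proof.
move=> cf cg ch t; rewrite /payment /pospart; case: r; last first.
  apply: cvgM; first exact: cvg_cst.
  by apply: (@continuous_max R T f h); [exact: cf | exact: ch].
apply: (@cvgD R R^o).
  apply: (@cvgB R R^o); apply: cvgM; try exact: cvg_cst; first exact: ch.
  apply: (@continuous_max R T (f \- h) (cst 0)); last exact: cvg_cst.
  by apply: (@cvgB R R^o); [exact: cf | exact: ch].
apply: cvgM; first exact: cvg_cst.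
by apply: (@cvg_norm R R^o); apply: (@cvgB R R^o); [exact: ch | exact: cg].
Qed.

(** Reports and consumption are continuous functions on an arbitrary space, which covers both fixed
    reports and joint variation of reports and consumption. *)
Lemma continuous_contract_profit (gamma p p2 b : R) (r : bool) f g h :
  gamma != 0 -> continuous f -> continuous g -> continuous h ->
  continuous (fun t => contract_profit gamma p p2 b r (f t) (g t) (h t)).
Proof.
move=> g0 cf cg ch t; apply: (@cvgB R R^o).
  exact: continuous_utility.
exact: continuous_payment.
Qed.

End continuity.

Lemma compact_consumptions {R : realType} (qmax : R) :
  compact (consumptions qmax).
Proof.
rewrite (_ : consumptions qmax = `[0, qmax]); first exact: segment_compact.
by apply/seteqP; split=> q /=; rewrite in_itv.
Qed.

Lemma compact_reports {R : realType} (qmax : R) : compact (reports qmax).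
Proof.
(* The triangle of reports is a compact square cut by a closed half-plane. *)
rewrite (_ : reports qmax = (consumptions qmax `*` consumptions qmax)
    `&` ((fun x : R * R => x.1 - x.2) @^-1` [set y | 0 <= y])).
  apply: compact_closedI.
    by apply: compact_setX; exact: compact_consumptions.
  apply: preimage_closed; last exact: closed_ge.
  by move=> x _; apply: (@cvgB R R^o); [exact: cvg_fst | exact: cvg_snd].
apply/seteqP; split=> -[u v] /=; rewrite /reports /consumptions /=.
  by move=> [? [? ?]]; do ![split]; lra.
by move=> [[/andP[? ?] /andP[? ?]] ?]; do ![split]; lra.
Qed.

(** With [t = p / gamma], the profit is [gamma * b ^+ 2 / 2] minus [gamma / 2 * (q - b) ^+ 2] up to
    saturation, and minus [gamma / 2 * t ^+ 2 + gamma * t * (q - (b + t))] beyond it. *)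
Lemma no_contract_profit_le {R : realType} (gamma p b q : R) :
  0 < gamma -> 0 <= p -> 0 <= b ->
  no_contract_profit gamma p b q <= gamma * b ^+ 2 / 2.
Proof.
move=> g0 p0 b0; rewrite /no_contract_profit utility_min ?gt_eqF//=.
have pg : gamma * (p / gamma) = p by field; rewrite gt_eqF.
set t := p / gamma in pg *.
have t0 : 0 <= t by rewrite divr_ge0// ltW.
(* Replacing [p] by [gamma * t] removes the division by [gamma], leaving polynomial inequalities. *)
rewrite -{}pg; case: (leP q) => hq.
  have : 0 <= gamma * (q - b) ^+ 2 by rewrite mulr_ge0 ?sqr_ge0// ltW.
  by nra.
have : 0 <= gamma * t * (q - (b + t))
  by rewrite -mulrA pmulr_rge0// mulr_ge0// subr_ge0 ltW.
have : 0 <= gamma * t ^+ 2 by rewrite mulr_ge0 ?sqr_ge0// ltW.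
by nra.
Qed.

Lemma no_contract_profit_baseline {R : realType} (gamma p b : R) :
  0 < gamma -> 0 <= p ->
  no_contract_profit gamma p b b = gamma * b ^+ 2 / 2.
Proof.
move=> g0 p0; rewrite /no_contract_profit /utility ifT; first by field.
by rewrite lerDl divr_ge0// ltW.
Qed.

(** When called, both incentive terms vanish; when not called, [Num.max b b] is [b]. Either way only
    [p * b] is paid. *)
Lemma contract_profit_truthful {R : realType} (gamma p p2 b : R) (r : bool) :
  contract_profit gamma p p2 b r b b b = no_contract_profit gamma p b b.
Proof.
rewrite /contract_profit /no_contract_profit /payment /pospart.
by rewrite subrr maxxx maxxx normr0 mulr0 subr0 addr0; case: r.
Qed.

Section maxima.
Context {R : realType} (gamma p p2 b qmax : R).
Hypotheses (g0 : gamma != 0) (qmax0 : 0 <= qmax).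

Lemma contract_profit_has_maximum (r : bool) (bhat qhat : R) :
  has_maximum (consumptions qmax) (contract_profit gamma p p2 b r bhat qhat).
Proof.
apply: continuous_has_maximum; last 1 first.
- apply: (@continuous_contract_profit _ _ _ _ _ _ _ (cst bhat) (cst qhat) id);
    by [| move=> t; exact: cvg_cst | move=> t; exact: cvg_id].
- by exists 0; rewrite /consumptions /= lexx.
- exact: compact_consumptions.
Qed.

Lemma expected_profit_has_maximum (pr : R) : 0 <= pr <= 1 ->
  has_maximum (reports qmax) (expected_profit gamma p p2 b qmax pr).
Proof.
move=> /andP[pr0 pr1].
pose C := consumptions qmax.
pose P r (x : R * R) q := contract_profit gamma p p2 b r x.1 x.2 q.
pose h (z : (R * R) * (R * R)) :=
  pr * P true z.1 z.2.1 + (1 - pr) * P false z.1 z.2.2.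
have [|||z [z1 [z21 z22]] hmax] :=
    @continuous_has_maximum R _ (reports qmax `*` (C `*` C)) h.
- exists ((0, 0), (0, 0)); rewrite /C /consumptions /reports /=.
  by do ![split]; rewrite ?lexx.
- apply: compact_setX; first exact: compact_reports.
  by apply: compact_setX; exact: compact_consumptions.
- move=> z.
  have c11 : continuous (fun z : (R * R) * (R * R) => z.1.1).
    by move=> y; apply: cvg_comp; [exact: cvg_fst | exact: cvg_fst].
  have c12 : continuous (fun z : (R * R) * (R * R) => z.1.2).
    by move=> y; apply: cvg_comp; [exact: cvg_fst | exact: cvg_snd].
  have c21 : continuous (fun z : (R * R) * (R * R) => z.2.1).
    by move=> y; apply: cvg_comp; [exact: cvg_snd | exact: cvg_fst].
  have c22 : continuous (fun z : (R * R) * (R * R) => z.2.2).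
    by move=> y; apply: cvg_comp; [exact: cvg_snd | exact: cvg_snd].
  apply: (@cvgD R R^o); apply: cvgM; try exact: cvg_cst.
    exact: (continuous_contract_profit _ _ _ _ true _ _ _ g0 c11 c12 c21).
  exact: (continuous_contract_profit _ _ _ _ false _ _ _ g0 c11 c12 c22).
exists z.1 => // y yD.
have PM r x q : C q -> P r x q <= maximum C (P r x).
  by apply: le_maximum; exact: contract_profit_has_maximum.
(* Best responses to the competing report [y] turn its expected profit into a value of [h], which is
   at most [h z]. *)
have [q1 [q1C eq1 _]] :=
  has_maximumP _ _ (contract_profit_has_maximum true y.1 y.2).
have [q0 [q0C eq0 _]] :=
  has_maximumP _ _ (contract_profit_has_maximum false y.1 y.2).
apply: (@le_trans _ _ (h z)).
  rewrite /expected_profit eq1 eq0.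
  exact: (hmax (y, (q1, q0))).
(* The consumptions in [z] do no better than the best responses to the report [z.1]. *)
by apply: lerD; apply: ler_wpM2l; rewrite ?subr_ge0//; exact: PM.
Qed.

End maxima.

Theorem corollary3 (R : realType) (gamma p p2 b qmax : R)
  (hgamma : 0 < gamma) (hp : 0 < p) (hp2 : p <= p2) (hb : 0 < b)
  (hqmax : b + p / gamma < qmax)
  (pr : R) (hpr : 0 <= pr <= 1) :
  (* every maximum below is attained *)
  (forall (r : bool) (x : R * R), reports qmax x ->
     has_maximum (consumptions qmax) (contract_profit gamma p p2 b r x.1 x.2)) /\
  has_maximum (reports qmax) (expected_profit gamma p p2 b qmax pr) /\
  has_maximum (consumptions qmax) (no_contract_profit gamma p b) /\
  optimal_no_contract_profit gamma p b qmax
    <= optimal_expected_profit gamma p p2 b qmax pr /\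
  optimal_no_contract_profit gamma p b qmax = gamma * b ^+ 2 / 2.
Proof.
have g0 : gamma != 0 by rewrite gt_eqF.
(* This makes [b] admissible both as a consumption and as either reported quantity. *)
have bq : b <= qmax by rewrite (le_trans _ (ltW hqmax))// lerDl divr_ge0 ?ltW.
have qmax0 : 0 <= qmax by apply: le_trans bq; exact: ltW.
have bC : consumptions qmax b by rewrite /consumptions /= bq ltW.
have bR : reports qmax (b, b) by rewrite /reports /=; do ![split]=> //; exact: ltW.
have bmax q : consumptions qmax q ->
    no_contract_profit gamma p b q <= no_contract_profit gamma p b b.
  by move=> _; rewrite no_contract_profit_baseline ?no_contract_profit_le ?ltW.
have optE := maximumE _ _ _ bC bmax.
have Emax := expected_profit_has_maximum _ p p2 b _ g0 qmax0 _ hpr.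
split; first by move=> r x _; exact: contract_profit_has_maximum.
split=> //; split; first by exists b.
split; last by rewrite /optimal_no_contract_profit optE no_contract_profit_baseline ?ltW.
apply: le_trans (le_maximum _ _ _ Emax bR).
rewrite /optimal_no_contract_profit optE /expected_profit /=.
have truthful r : no_contract_profit gamma p b b <=
    maximum (consumptions qmax) (contract_profit gamma p p2 b r b b).
  rewrite -(contract_profit_truthful _ _ p2 _ r).
  by apply: le_maximum => //; exact: contract_profit_has_maximum.
case/andP: hpr => pr0 pr1.
(* Splitting the no-contract payoff with weights [pr] and [1 - pr] allows a comparison state by
   state. *)
rewrite -[leLHS]mul1r -[X in X * _ <= _](subrKC pr) mulrDl.
by apply: lerD; apply: ler_wpM2l; rewrite ?subr_ge0.
Qed.
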